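(* Let $r\ge2$ be an integer and let $\ell$ be the positive integer such that $2^{\ell-1}<r\le2^\ell$. Then for every $n\ge r$ with $n\equiv r+1\pmod{2^\ell}$, the consecutive union $X_1\cup X_2\cup\cdots\cup X_r$ in $\mathcal{H}(n,2)$ has balanced fractional revival at time $\pi/4$.
   Context: The graph $X_j$ in the binary Hamming scheme $\mathcal{H}(n,2)$ has as vertices the binary sequences of length $n$, two being adjacent iff their Hamming distance is exactly $j$; the union $X_1\cup\cdots\cup X_r$ has adjacency matrix $A=A(X_1)+\cdots+A(X_r)$. Let $U(t)=e^{-\mathrm{i}tA}$. Balanced fractional revival at time $\tau$ means that there are vertices $a\ne b$ and complex $\alpha,\beta$ with $|\alpha|=|\beta|=1/\sqrt2$ and $U(\tau)\mathbf{e}_a=\alpha\mathbf{e}_a+\beta\mathbf{e}_b$. (In $\mathcal{H}(n,2)$ with $n\ge 2$ this is equivalent to $U(\tau)=\alpha I+\beta A_n$ with $A_n$ the adjacency matrix of $X_n$.) *)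

(* Defs.v *)
From mathcomp Require Import all_boot all_order all_algebra.
From mathcomp Require Import complex.
From mathcomp Require Import all_classical all_reals all_analysis.

Set Implicit Arguments.
Unset Strict Implicit.
Unset Printing Implicit Defensive.

Import Order.TTheory GRing.Theory Num.Theory.
Import numFieldNormedType.Exports.

Local Open Scope classical_set_scope.
Local Open Scope ring_scope.

(* R[i]^o is R[i] with the topology given by its norm; matrices over it carry
   the product topology, in which the limit below is taken. *)
Definition expmx (R : realType) (N : nat) (M : 'M[R[i]]_N) : 'M[R[i]]_N :=
  limn (fun m => \sum_(k < m) (k`!%:R^-1 : R[i]) *: M ^+ k : 'M[R[i]^o]_N).

Definition transition_mx (R : realType) (N : nat) (A : 'M[R[i]]_N) (t : R) :
  'M[R[i]]_N := expmx (- ('i * t%:C)%C *: A).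

(* MathComp matrices are indexed by ordinals: the row and column of a vertex
   x : T is enum_rank x. *)
Definition adjacency_mx (R : realType) (T : finType) (e : rel T) :
  'M[R[i]]_#|T| := \matrix_(x, y) (e (enum_val x) (enum_val y))%:R.

Definition vertex_vec (R : realType) (T : finType) (a : T) : 'cV[R[i]]_#|T| :=
  delta_mx (enum_rank a) 0.

Definition balanced_fractional_revival (R : realType) (T : finType)
    (e : rel T) (tau : R) : Prop :=
  exists (a b : T) (alpha beta : R[i]),
    [/\ a != b,
        `|alpha| = (sqrtC 2)^-1,
        `|beta| = (sqrtC 2)^-1 &
        transition_mx (adjacency_mx R e) tau *m vertex_vec R a =
          alpha *: vertex_vec R a + beta *: vertex_vec R b].

Definition hamming_dist (n : nat) (x y : n.-tuple bool) : nat :=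
  #|[pred i : 'I_n | tnth x i != tnth y i]|.

Definition hamming_graph (n j : nat) : rel (n.-tuple bool) :=
  fun x y => hamming_dist x y == j.

Definition consecutive_union (n r : nat) : rel (n.-tuple bool) :=
  fun x y => [exists j : 'I_r.+1, (1 <= j)%N && hamming_graph j x y].

Lemma adjacency_consecutive_union (R : realType) (n r : nat) :
  adjacency_mx R (@consecutive_union n r) =
  \sum_(1 <= j < r.+1) adjacency_mx R (@hamming_graph n j).
Proof.
apply/matrixP => x y; rewrite summxE mxE /consecutive_union /hamming_graph.
set d := hamming_dist _ _.
have -> : \sum_(1 <= j < r.+1) adjacency_mx R (@hamming_graph n j) x y =
          \sum_(1 <= j < r.+1) (d == j)%:R.
  by apply: eq_bigr => j _; rewrite mxE.
have [/andP[d1 dr]|nd] := boolP (1 <= d <= r)%N.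
  have -> : [exists j : 'I_r.+1, (0 < j)%N && (d == j)].
    by apply/existsP; exists (inord d); rewrite inordK ?d1 ?eqxx.
  rewrite (bigD1_seq d) ?iota_uniq ?mem_index_iota ?d1 /= ?eqxx ?big1 ?addr0 //.
  by move=> j /negbTE; rewrite eq_sym => ->.
rewrite big_nat_cond big1 => [|j /andP[]/andP[j1 jr] _].
  case: existsP => // -[j /andP[j1 /eqP dj]]; case/negP: nd.
  by rewrite dj j1 -ltnS ltn_ord.
case: eqP => // dj; case/negP: nd; rewrite dj j1 -ltnS jr //.
Qed.

(* Main.v *)
(* The characters (-1)^|x & y| of the cube diagonalize the union. At a vertex of
   weight s the eigenvalue is T(s) - 1, where T(s) sums the coefficients of
   degree at most r of (1 - X)^s (1 + X)^(n - s). Then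
   T(s) - T(s + 2) = 4 S(s, n - s - 2) and T(0) - T(1) = 2 S(0, n - 1), where
   S(s, t) sums the coefficients of degree at most r - 1 of (1 - X)^s (1 + X)^t,
   and S(s, t) = 'C(s + t - 1, r - 1) modulo 2. As n = r + 1 modulo 2^l and
   r - 1 < 2^l, the binomial 'C(n - 3, r - 1) has the parity of
   'C(r - 2, r - 1) = 0, and 'C(n - 2, r - 1) that of 'C(r - 1, r - 1) = 1.
   So T mod 8 only depends on the parity of s, and T(0) - T(1) = 2 modulo 4. At
   time pi/4 the phases are then constant on each parity class and differ by a
   right angle, which is balanced revival between 0...0 and 1...1. *)
Require Import Defs.
From mathcomp Require Import all_boot all_order all_algebra.
From mathcomp Require Import complex.
From mathcomp Require Import all_classical all_reals all_analysis.
From mathcomp Require Import ring lra zify.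

Import Order.TTheory GRing.Theory Num.Theory.
Import numFieldNormedType.Exports.

Local Open Scope classical_set_scope.
Local Open Scope ring_scope.

(** * Exponential of a diagonalized matrix *)

Lemma cvg_mx_entries (T : ptopologicalType) (p q : nat)
    (u : nat -> 'M[T]_(p, q)) (M : 'M[T]_(p, q)) :
  (forall i j, u n i j @[n --> \oo] --> M i j) -> u n @[n --> \oo] --> M.
Proof.
move=> uM A [P MP sPA]; near=> n; apply: sPA => i j /=; move: i j; near: n.
apply: filter_forall => i; apply: filter_forall => j.
exact: (uM i j _ (MP i j)).
Unshelve. all: by end_near.
Qed.

Lemma exp_diagonalized (K : fieldType) (N k : nat) (H G : 'M[K]_N)
    (d : 'rV[K]_N) :
  G *m H = 1%:M ->
  (H *m diag_mx d *m G) ^+ k = H *m diag_mx (\row_i d 0 i ^+ k) *m G.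
Proof.
move=> GH; elim: k => [|k IHk].
  have -> : \row_i d 0 i ^+ 0 = const_mx 1 by apply/rowP => i; rewrite !mxE.
  by rewrite diag_const_mx mulmx1 (mulmx1C GH).
rewrite exprSr IHk -[_ * _]/(_ *m _) !mulmxA -(mulmxA _ G) GH mulmx1.
congr (_ *m _); rewrite -mulmxA mulmx_diag.
by do 2?congr (_ *m _); congr diag_mx; apply/rowP => i; rewrite !mxE exprSr.
Qed.

(** Each entry of a partial sum is a fixed linear combination of the scalar partial sums at the
    eigenvalues, so scalar convergence suffices. *)
Lemma expmx_diagonalized (R : realType) (N : nat) (H G : 'M[R[i]]_N)
    (d e : 'rV[R[i]]_N) :
  G *m H = 1%:M ->
  (forall i, (\sum_(k < m) k`!%:R^-1 * d 0 i ^+ k : R[i]^o) @[m --> \oo]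
               --> (e 0 i : R[i]^o)) ->
  expmx (H *m diag_mx d *m G) = H *m diag_mx e *m G.
Proof.
move=> GH de.
have entry f x y : (H *m diag_mx f *m G) x y = \sum_j H x j * G j y * f 0 j.
  by rewrite mxE; apply: eq_bigr => j _; rewrite mul_mx_diag mxE mulrAC.
apply: (@cvg_lim 'M[R[i]^o]_N); first exact: norm_hausdorff.
apply: cvg_mx_entries => x y; rewrite entry.
under eq_cvg => m.
  have -> : (\sum_(k < m)
      (k`!%:R^-1 : R[i]) *: (H *m diag_mx d *m G) ^+ k) x y =
            \sum_j H x j * G j y * \sum_(k < m) k`!%:R^-1 * d 0 j ^+ k.
    rewrite summxE; under [RHS]eq_bigr do rewrite mulr_sumr.
    rewrite [RHS]exchange_big; apply: eq_bigr => k _.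
    rewrite mxE exp_diagonalized// entry mulr_sumr; apply: eq_bigr => j _.
    by rewrite mxE; ring.
  over.
apply: (@cvg_big R[i]^o _ +%R 0 xpredT (@add_continuous R[i]^o)) => j _.
exact: (@cvgMl_tmp R[i] _ _ _ _ _ _ (de j)).
Qed.

(** * Scalar exponential series on the imaginary axis *)

Definition cis {R : realType} (x : R) : R[i] := (cos x +i* sin x)%C.

Lemma cvg_real_complex (R : realType) (u : nat -> R) (a : R) :
  u n @[n --> \oo] --> a ->
  ((u n)%:C%C : R[i]^o) @[n --> \oo] --> (a%:C%C : R[i]^o).
Proof.
move=> /cvgrPdist_lt ua; apply/cvgrPdist_lt => -[e e'].
(* A positive element of [R[i]] has zero imaginary part, so the radius is real. *)
rewrite ltcE /= => /andP[/eqP-> e0]; near=> n.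
rewrite -rmorphB normc_def /= expr0n addr0 sqrtr_sqr ltcR.
by near: n; exact: ua.
Unshelve. all: by end_near.
Qed.

Lemma cvg_exp_series_i (R : realType) (x : R) :
  (\sum_(k < m) k`!%:R^-1 * ('i * x%:C)%C ^+ k : R[i]^o) @[m --> \oo]
    --> (cis x : R[i]^o).
Proof.
have term k : k`!%:R^-1 * ('i * x%:C)%C ^+ k =
    (cos_coeff x k)%:C%C + 'i * (sin_coeff x k)%:C%C :> R[i].
  (* With [b] the parity of [k], the power of ['i] is ['i ^+ b * (-1) ^+ m]: even terms feed the
     cosine, odd ones the sine. *)
  have [m [b ->]] : exists m (b : bool), k = (b + m.*2)%N.
    by exists k./2, (odd k); rewrite odd_double_half.
  rewrite exprMn exprD -mul2n exprM sqrCi /cos_coeff /sin_coeff /=.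
  rewrite mul2n; have -> : odd (b + m.*2) = b.
    by case: (b); rewrite /= odd_double.
  case: b; rewrite /= ?add0n ?add1n /= ?doubleK -?exprnP !(mul0r, mul1r) rmorph0
    ?(mulr0, addr0, add0r) !rmorphM fmorphV rmorphXn rmorphN1 rmorphXn
    rmorph_nat.
    by rewrite /= expr1; ring.
  by rewrite /=; ring.
have cv : series (cos_coeff x) @ \oo --> cos x.
  by rewrite unlock; exact: is_cvg_series_cos_coeff.
have sv : series (sin_coeff x) @ \oo --> sin x.
  by rewrite unlock; exact: is_cvg_series_sin_coeff.
have -> : cis x = (cos x)%:C%C + 'i * (sin x)%:C%C.
  by rewrite [LHS]complexE complexiE.
under eq_cvg => m.
  under eq_bigr do rewrite term.
  rewrite big_split -mulr_sumr -!rmorph_sum -!(big_mkord xpredT) /=.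
  over.
apply: (@cvgD _ R[i]^o); first exact: cvg_real_complex.
by apply: (@cvgMl_tmp R[i]); exact: cvg_real_complex.
Qed.

(** * Parity of binomial coefficients *)

(** Since [2 ^ l] divides [i * 'C(2 ^ l, i)], an odd binomial would force it to divide the smaller
    number [i]. *)
Lemma odd_bin_expn2 (l i : nat) : (0 < i < 2 ^ l)%N -> odd 'C(2 ^ l, i) = false.
Proof.
case: i => // i /andP[_ il]; apply: contraTF il => oddC; rewrite -leqNgt.
apply: dvdn_leq => //; rewrite -(@Gauss_dvdl _ _ 'C(2 ^ l, i.+1)).
  by rewrite -mul_bin_diag dvdn_mulr.
by apply: coprimeXl; rewrite coprime2n.
Qed.

(** In the Vandermonde sum, every term but the one taking nothing from the [2 ^ l] part is even. *)
Lemma odd_bin_addn_expn2 (N l k : nat) :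
  (k < 2 ^ l)%N -> odd 'C(N + 2 ^ l, k) = odd 'C(N, k).
Proof.
move=> kl; rewrite addnC -binomial.Vandermonde big_ord_recl /= bin0 mul1n subn0.
rewrite oddD [X in _ (+) X](_ : _ = false) ?addbF//; apply/negbTE.
elim/big_ind: _ => // [m p /negbTE om /negbTE op|i _].
  by rewrite oddD om op.
by rewrite oddM odd_bin_expn2 // /bump /= add1n (leq_ltn_trans _ kl).
Qed.

Lemma odd_bin_addn_mul_expn2 (N q l k : nat) :
  (k < 2 ^ l)%N -> odd 'C(N + q * 2 ^ l, k) = odd 'C(N, k).
Proof.
move=> kl; elim: q => [|q IHq]; first by rewrite addn0.
by rewrite mulSn addnCA addnC odd_bin_addn_expn2.
Qed.

(** * Partial sums of Krawtchouk coefficients and their congruences *)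

Definition coef_psum (k : nat) (p : {poly int}) : int := \sum_(j < k.+1) p`_j.

Lemma coef_psumB k p q : coef_psum k (p - q) = coef_psum k p - coef_psum k q.
Proof. by rewrite /coef_psum -sumrB; apply: eq_bigr => j _; rewrite coefB. Qed.

Lemma coef_psumZ k a p : coef_psum k (a *: p) = a * coef_psum k p.
Proof.
by rewrite /coef_psum mulr_sumr; apply: eq_bigr => j _; rewrite coefZ.
Qed.

Lemma coef_psumXM k p : coef_psum k.+1 ('X * p) = coef_psum k p.
Proof.
rewrite /coef_psum big_ord_recl coefXM add0r.
by apply: eq_bigr => j _; rewrite coefXM.
Qed.

Lemma coef_psum_1BXM k p : coef_psum k ((1 - 'X) * p) = p`_k.
Proof.
rewrite mulrBl mul1r coef_psumB; case: k => [|k].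
  by rewrite /coef_psum !big_ord1 coefXM subr0.
by rewrite coef_psumXM /coef_psum big_ord_recr addrC addKr.
Qed.

(** The coefficient of degree [j] is the Krawtchouk polynomial of degree [j] for length [s + t],
    evaluated at [s]. *)
Definition krawtchouk_gen (s t : nat) : {poly int} :=
  (1 - 'X) ^+ s * (1 + 'X) ^+ t.

Lemma coef_1DX_exp t k : ((1 + 'X) ^+ t : {poly int})`_k = 'C(t, k)%:R.
Proof.
elim: t k => [|t IHt] k; first by rewrite expr0 coef1; case: k.
rewrite exprS mulrDl mul1r coefD coefXM IHt; case: k => [|k].
  by rewrite !bin0 addr0.
by rewrite IHt binS natrD.
Qed.

(** From [(1 + 'X) - (1 - 'X) = 2 'X]; the factor ['X] lowers the degree bound by one. *)
Lemma coef_psum_krawtchoukB k s t :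
  coef_psum k.+1 (krawtchouk_gen s t.+1) -
    coef_psum k.+1 (krawtchouk_gen s.+1 t) =
  2 * coef_psum k (krawtchouk_gen s t).
Proof.
rewrite -coef_psumZ -(coef_psumXM k) -coef_psumB; congr coef_psum.
by rewrite /krawtchouk_gen -mul_polyC !exprS; ring.
Qed.

(** Likewise from [(1 + 'X) ^+ 2 - (1 - 'X) ^+ 2 = 4 'X]. *)
Lemma coef_psum_krawtchoukB2 k s t :
  coef_psum k.+1 (krawtchouk_gen s t.+2) -
    coef_psum k.+1 (krawtchouk_gen s.+2 t) =
  4 * coef_psum k (krawtchouk_gen s t).
Proof.
rewrite -coef_psumZ -(coef_psumXM k) -coef_psumB; congr coef_psum.
by rewrite /krawtchouk_gen -mul_polyC !exprS; ring.
Qed.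

(* Modulo 2 the weight does not matter, and at weight 1 the sum telescopes to a
   single coefficient. *)
Lemma coef_psum_krawtchouk_mod2 k s t N : (s + t = N.+1)%N ->
  (2 %| coef_psum k (krawtchouk_gen s t) - 'C(N, k)%:R)%Z.
Proof.
have wt1 : coef_psum k (krawtchouk_gen 1 N) = 'C(N, k)%:R.
  by rewrite /krawtchouk_gen expr1 coef_psum_1BXM coef_1DX_exp.
have step i j : (2 %| coef_psum k (krawtchouk_gen i j.+1) -
                      coef_psum k (krawtchouk_gen i.+1 j))%Z.
  (* The difference formula needs a positive degree bound; at bound 0 both sums are the constant
     coefficient 1. *)
  case: k {wt1} => [|k]; last by rewrite coef_psum_krawtchoukB dvdz_mulr.
  rewrite /coef_psum !big_ord1 -!horner_coef0 /krawtchouk_gen.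
  by rewrite !hornerE !expr1n subrr.
case: s => [|s]; first by rewrite add0n => ->; rewrite -wt1; exact: step.
elim: s t => [|s IHs] t; first by rewrite add1n => -[->]; rewrite wt1 subrr.
rewrite addSnnS => /IHs; rewrite -(@rpredBr _ _ _ _ (step s.+1 t)).
  by congr (_ %| _)%Z; ring.
Qed.

(** Descend in [s] by two: each step costs 4 times a sum congruent to ['C(N, k)] modulo 2, hence
    even. *)
Lemma coef_psum_krawtchouk_mod8 k N s : odd 'C(N, k) = false -> (s <= N.+3)%N ->
  (8 %| coef_psum k.+1 (krawtchouk_gen s (N.+3 - s)) -
        coef_psum k.+1 (krawtchouk_gen (odd s) (N.+3 - odd s)))%Z.
Proof.
move=> evC; rewrite -{1 2 3}(odd_double_half s).
elim: s./2 => [|h IHh] sN; first by rewrite addn0 subrr.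
have /IHh : (odd s + h.*2 <= N.+3)%N by lia.
set b := (odd s + h.*2)%N in IHh *.
have -> : (N.+3 - b = (N.+1 - b).+2)%N by lia.
have -> : (odd s + h.+1.*2 = b.+2)%N by lia.
have -> : (N.+3 - b.+2 = N.+1 - b)%N by lia.
have /(coef_psum_krawtchouk_mod2 k) : (b + (N.+1 - b) = N.+1)%N by lia.
have := coef_psum_krawtchoukB2 k b (N.+1 - b).
move: (odd_double_half 'C(N, k)); rewrite evC; lia.
Qed.

Lemma coef_psum_krawtchouk_mod4 k N : odd 'C(N.+1, k) ->
  (4 %| coef_psum k.+1 (krawtchouk_gen 0 N.+3) -
        coef_psum k.+1 (krawtchouk_gen 1 N.+2) - 2)%Z.
Proof.
move=> oddC; have := coef_psum_krawtchoukB k 0 N.+2.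
have := coef_psum_krawtchouk_mod2 k 0 N.+2 N.+1 erefl.
move: (odd_double_half 'C(N.+1, k)); rewrite oddC; lia.
Qed.

(** * Characters of the cube *)

Lemma sum_tuple_prod (K : comPzSemiRingType) (n : nat) (F : 'I_n -> bool -> K) :
  \sum_(x : n.-tuple bool) \prod_i F i (tnth x i) =
  \prod_i (F i true + F i false).
Proof.
under [RHS]eq_bigr do rewrite -big_bool.
rewrite bigA_distr_bigA.
rewrite (reindex (fun f : {ffun 'I_n -> bool} => [tuple f i | i < n])).
  by apply: eq_bigr => f _; apply: eq_bigr => i _; rewrite tnth_mktuple.
exists (fun x => [ffun i => tnth x i]) => [f|x] _.
  by apply/ffunP => i; rewrite ffunE tnth_mktuple.
by apply: eq_from_tnth => i; rewrite tnth_mktuple ffunE.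
Qed.

Definition cube_char {n : nat} (x y : n.-tuple bool) : int :=
  \prod_i (-1) ^+ (tnth x i && tnth y i).

Definition hamming_weight {n : nat} (x : n.-tuple bool) : nat :=
  #|[pred i : 'I_n | tnth x i]|.

Lemma hamming_weight_le (n : nat) (x : n.-tuple bool) :
  (hamming_weight x <= n)%N.
Proof. by rewrite -[leqRHS]card_ord max_card. Qed.

(** The sum factors over coordinates: one where [x] and [z] agree contributes 2, one where they
    differ contributes 0. *)
Lemma cube_char_orthogonal (n : nat) (x z : n.-tuple bool) :
  \sum_y cube_char x y * cube_char y z = 2 ^+ n * (x == z)%:R.
Proof.
under eq_bigr do rewrite -big_split.
rewrite (sum_tuple_prod _ _
  (fun i b => (-1) ^+ (tnth x i && b) * (-1) ^+ (b && tnth z i))).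
have [<-|xz] := eqVneq x z.
  rewrite mulr1 -[in RHS](card_ord n) -prodr_const; apply: eq_bigr => i _.
  by rewrite andbT andbF; case: (tnth x i).
rewrite mulr0; have /existsP[i xzi] : [exists i, tnth x i != tnth z i].
  rewrite -negb_forall; apply: contra xz => /forallP xz.
  by apply/eqP/eq_from_tnth => i; apply/eqP.
rewrite (bigD1 i)//= andbT andbF.
by case: (tnth x i) (tnth z i) xzi => [] [] // _; rewrite mul0r.
Qed.

(** The sum factors over coordinates: keeping or flipping bit [i] of [x] gives the character factor
    of [x] times [1 - 'X] if [s] has bit [i] set, and [1 + 'X] otherwise. *)
Lemma sum_cube_char_dist (n : nat) (x s : n.-tuple bool) :
  \sum_y (cube_char y s)%:P * 'X^(hamming_dist x y) =
  (cube_char x s)%:P * krawtchouk_gen (hamming_weight s) (n - hamming_weight s).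
Proof.
have charP y :
    (cube_char y s)%:P = \prod_i (-1) ^+ (tnth y i && tnth s i) :> {poly int}.
  by rewrite rmorph_prod; apply: eq_bigr => i _; rewrite rmorphXn rmorphN1.
pose F i b : {poly int} := (-1) ^+ (b && tnth s i) * 'X ^+ (tnth x i != b).
transitivity (\sum_(y : n.-tuple bool) \prod_i F i (tnth y i)).
  apply: eq_bigr => y _; rewrite big_split charP; congr (_ * _).
  rewrite /= prodrXr; congr (_ ^+ _); rewrite /hamming_dist -sum1_card big_mkcond.
  by apply: eq_bigr => i _; rewrite inE; case: (_ != _).
rewrite sum_tuple_prod.
transitivity ((cube_char x s)%:P *
    \prod_i (if tnth s i then 1 - 'X else 1 + 'X : {poly int})).
  rewrite charP -big_split; apply: eq_bigr => i _; rewrite /F.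
  by case: (tnth x i) (tnth s i) => [] [] /=; ring.
congr (_ * _); rewrite (bigID (tnth s)) /=; congr (_ * _).
  rewrite (eq_bigr (fun=> 1 - 'X)) => [|i ->]//.
  by rewrite prodr_const.
rewrite (eq_bigr (fun=> 1 + 'X)) => [|i /negbTE->]//.
rewrite prodr_const; congr (_ ^+ _).
by apply: (canRL (addKn _)); rewrite -[RHS](card_ord n) -(cardC (tnth s)).
Qed.

(** Compare coefficients of degrees 1 to [r]; the [- 1] removes the constant coefficient, that is,
    distance 0. *)
Lemma sum_cube_char_ball (n r : nat) (x s : n.-tuple bool) :
  \sum_(1 <= j < r.+1) \sum_y (hamming_dist x y == j)%:R * cube_char y s =
  cube_char x s * (coef_psum r
    (krawtchouk_gen (hamming_weight s) (n - hamming_weight s)) - 1).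
Proof.
set p := krawtchouk_gen _ _.
have -> : coef_psum r p - 1 = \sum_(1 <= j < r.+1) p`_j.
  rewrite /coef_psum -(big_mkord xpredT (fun j => p`_j)) big_ltn// addrAC.
  suff -> : p`_0 = 1 by rewrite subrr add0r.
  by rewrite -horner_coef0 /p /krawtchouk_gen !hornerE !expr1n mulr1.
rewrite mulr_sumr; apply: eq_bigr => j _.
rewrite -coefCM -sum_cube_char_dist coef_sum; apply: eq_bigr => y _.
by rewrite coefCM coefXn mulrC eq_sym.
Qed.

Lemma cube_char0 (n : nat) (x : n.-tuple bool) :
  cube_char x [tuple false | _ < n] = 1.
Proof. by rewrite /cube_char big1// => i _; rewrite tnth_mktuple andbF. Qed.

Lemma cube_char1 (n : nat) (x : n.-tuple bool) :
  cube_char x [tuple true | _ < n] = (-1) ^+ (odd (hamming_weight x)).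
Proof.
rewrite /cube_char prodrXr signr_odd; congr (_ ^+ _).
rewrite /hamming_weight -sum1_card [RHS]big_mkcond.
by apply: eq_bigr => i _; rewrite tnth_mktuple andbT inE; case: (tnth x i).
Qed.

(** * Phases of the transition matrix *)

Lemma transition_mx_diagonalized (R : realType) (N : nat) (H G : 'M[R[i]]_N)
    (theta : 'I_N -> R) (t : R) :
  G *m H = 1%:M ->
  transition_mx (H *m diag_mx (\row_j (theta j)%:C%C) *m G) t =
  H *m diag_mx (\row_j cis (- (t * theta j))) *m G.
Proof.
move=> GH; rewrite /transition_mx scalemxAl scalemxAr -linearZ /=.
apply: expmx_diagonalized => // j; rewrite !mxE.
have -> : - ('i * t%:C%C) * (theta j)%:C%C =
    'i * (- (t * theta j))%:C%C :> R[i].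
  by rewrite rmorphN rmorphM /=; ring.
exact: cvg_exp_series_i.
Qed.

Lemma cis_addz2pi (R : realType) (x : R) (k : int) :
  cis (x + k%:~R * (pi *+ 2)) = cis x.
Proof.
have cis2pi (y : R) (n : nat) : cis (y + n%:R * (pi *+ 2)) = cis y.
  elim: n => [|n IHn]; first by rewrite mul0r addr0.
  by rewrite -(natr1 n) mulrDl mul1r addrA [LHS]/cis sinD2pi cosD2pi.
case: k => n; first exact: cis2pi.
by rewrite -[LHS](cis2pi _ n.+1) NegzE mulrNz mulNr subrK.
Qed.

Lemma cos_pihalf_addzpi (R : realType) (k : int) :
  cos (pi / 2 + k%:~R * pi : R) = 0.
Proof.
have cosn n : cos (pi / 2 + n%:R * pi : R) = 0.
  elim: n => [|n IHn]; first by rewrite mul0r addr0 cos_pihalf.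
  by rewrite -(natr1 n) [X in _ + X]mulrDl mul1r addrA cosDpi IHn oppr0.
case: k => n; first exact: cosn.
have -> : pi / 2 + (Negz n)%:~R * pi = - (pi / 2 + n%:R * pi) :> R.
  by rewrite NegzE mulrNz -[(n.+1)%:~R]/(n.+1%:R) -(natr1 n); field.
by rewrite cosN.
Qed.

(** The squared modulus of the numerator is [2 + 2 * (-1) ^+ e * cos (a - b)], which is 2 for phases
    at a right angle. *)
Lemma norm_half_cis (R : realType) (a b : R) (e : bool) : cos (a - b) = 0 ->
  `|(cis a + (-1) ^+ e * cis b) / 2| = (sqrtC 2)^-1 :> R[i].
Proof.
move=> ab; apply/eqP; rewrite -(@eqrXn2 _ 2)// ?invr_ge0 ?sqrtC_ge0//.
rewrite exprVn sqrtCK normrM exprMn normfV normr_nat.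
have -> : (-1) ^+ e = ((-1) ^+ e : R)%:C%C :> R[i] by rewrite rmorphXn rmorphN1.
rewrite -add_Re2_Im2 /=.
set S : R := (-1) ^+ e; have S2 : S ^+ 2 = 1.
  by rewrite -exprM mulnC exprM sqrrN !expr1n.
have -> : (cos a + (S * cos b - 0 * sin b)) ^+ 2 +
    (sin a + (S * sin b + 0 * cos b)) ^+ 2 =
    (cos a ^+ 2 + sin a ^+ 2) + S ^+ 2 * (cos b ^+ 2 + sin b ^+ 2) +
    2 * S * cos (a - b) by rewrite cosB; ring.
rewrite !cos2Dsin2 S2 ab mulr0 addr0 mul1r -[1 + 1]/(2%:R) rmorph_nat.
by apply/eqP; field.
Qed.

(** * Diagonalization by the character matrix *)

(** A Hadamard matrix of Sylvester type. *)
Definition cube_char_mx (K : pzRingType) (n : nat) :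
    'M[K]_#|{: n.-tuple bool}| :=
  \matrix_(x, y) (cube_char (enum_val x) (enum_val y))%:~R.

Lemma sum_enum_val (K : nmodType) (T : finType) (F : T -> K) :
  \sum_(j < #|T|) F (enum_val j) = \sum_x F x.
Proof. by rewrite -big_enum_val. Qed.

Lemma cube_char_mx_sqr (K : comPzRingType) (n : nat) :
  cube_char_mx K n *m cube_char_mx K n = (2 ^+ n)%:M.
Proof.
apply/matrixP => x z; rewrite !mxE.
under eq_bigr do rewrite !mxE -intrM.
rewrite -rmorph_sum (sum_enum_val _ _ (fun y => cube_char _ y * cube_char y _)).
rewrite cube_char_orthogonal rmorphM rmorphXn /= (inj_eq enum_val_inj).
by rewrite !rmorph_nat mulr_natr.
Qed.

Lemma adjacency_consecutive_union_eigen (R : realType) (n r : nat) :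
  adjacency_mx R (@consecutive_union n r) *m cube_char_mx _ n =
  cube_char_mx _ n *m diag_mx (\row_j
    (coef_psum r (krawtchouk_gen (hamming_weight (enum_val j))
       (n - hamming_weight (enum_val j))) - 1)%:~R).
Proof.
rewrite adjacency_consecutive_union mulmx_suml; apply/matrixP => x s.
rewrite summxE mul_mx_diag !mxE -intrM -sum_cube_char_ball rmorph_sum.
apply: eq_bigr => j _; rewrite !mxE rmorph_sum -[RHS]sum_enum_val.
by apply: eq_bigr => y _; rewrite !mxE rmorphM /= rmorph_nat.
Qed.

(** * Balanced revival at time [pi / 4] *)

Theorem proposition4p15 (R : realType) (r l : nat)
    (hr : (2 <= r)%N) (hl : (0 < l)%N)
    (hrl : (2 ^ (l - 1) < r <= 2 ^ l)%N)
    (n : nat) (hnr : (r <= n)%N) (hn : n = r + 1 %[mod 2 ^ l]) :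
  balanced_fractional_revival (@consecutive_union n r) (pi / 4 : R).
Proof.
have [k [rE k_gt0 k_lt]] : exists k, [/\ r = k.+1, (0 < k)%N & (k < 2 ^ l)%N].
  by case/andP: hrl => _; case: (r) hr => // k; exists k.
have [N [nE oddN oddN1]] : exists N,
    [/\ n = N.+3, odd 'C(N, k) = false & odd 'C(N.+1, k)].
  (* Equality would give [1 = 0] modulo [2 ^ l], impossible as [l] is positive. *)
  have ln : (r < n)%N.
    rewrite ltn_neqAle hnr andbT; apply/eqP => rn; move/eqP: hn.
    rewrite -rn eq_sym -[X in _ == X %[mod _]]addn0 eqn_modDl mod0n.
    by rewrite modn_small// -(expn0 2) ltn_exp2l.
  (* Here [r + 1 = k.-1 + 3], so the two parities reduce to those of ['C(k.-1, k) = 0] and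
     ['C(k, k) = 1]. *)
  have [q qE] : exists q, n = (k.-1 + q * 2 ^ l).+3.
    exists ((n - (r + 1)) %/ 2 ^ l)%N.
    rewrite divnK; first by lia.
    by rewrite -eqn_mod_dvd ?addn1//; apply/eqP; rewrite hn addn1.
  exists (k.-1 + q * 2 ^ l)%N; split=> //.
    by rewrite odd_bin_addn_mul_expn2// bin_small// prednK.
  by rewrite -addSn odd_bin_addn_mul_expn2// prednK// binn.
pose T s := coef_psum r (krawtchouk_gen s (n - s)).
pose a s : R := - (pi / 4 * (T s - 1)%:~R).
have cis_weight s : (s <= n)%N -> cis (a s) = cis (a (odd s)).
  rewrite nE => /(coef_psum_krawtchouk_mod8 _ _ _ oddN).
  rewrite -rE -nE -/(T s) -/(T (odd s)).
  (* Adding [8 z] to the eigenvalue turns the phase by [- z] full turns. *)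
  move=> /dvdzP[z zE]; rewrite -(cis_addz2pi _ (a (odd s)) (- z)); congr cis.
  rewrite /a (_ : T s = T (odd s) + z * 8); last by rewrite -zE; ring.
  by rewrite !(rmorphD, rmorphB, rmorphM, rmorphN) /=; field.
have cos_a01 : cos (a 0%N - a 1%N) = 0.
  move: (coef_psum_krawtchouk_mod4 _ _ oddN1); rewrite -rE.
  have -> : N.+3 = (n - 0)%N by rewrite nE.
  have -> : N.+2 = (n - 1)%N by rewrite nE subn1.
  move=> /dvdzP[z zE].
  (* An eigenvalue gap of [2 + 4 z] gives the phase difference [- (pi / 2 + z * pi)]. *)
  rewrite -(cos_pihalf_addzpi R z) -cosN /a; congr cos.
  rewrite (_ : T 0%N = T 1%N + 2 + z * 4); last by rewrite -zE /T; ring.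
  by rewrite !(rmorphD, rmorphB, rmorphM, rmorphN) /=; field.
(* These solve [alpha + beta = cis (a 0)] and [alpha - beta = cis (a 1)]. *)
pose alpha := (cis (a 0%N) + (-1) ^+ false * cis (a 1%N)) / 2.
pose beta := (cis (a 0%N) + (-1) ^+ true * cis (a 1%N)) / 2.
have ab_cis (b : bool) : cis (a b) = alpha + (-1) ^+ b * beta.
  by rewrite /alpha /beta; case: b; rewrite !(expr0, expr1); field.
exists [tuple false | _ < n], [tuple true | _ < n], alpha, beta; split.
- have n_gt0 : (0 < n)%N by rewrite nE.
  apply/eqP => /(congr1 (fun x => tnth x (Ordinal n_gt0))).
  by rewrite !tnth_mktuple.
- exact: norm_half_cis.
- exact: norm_half_cis.
set H := cube_char_mx R[i] n; set G := (2 ^+ n)^-1 *: H.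
have two_n0 : (2 ^+ n : R[i]) != 0 by rewrite expf_neq0.
have GH : G *m H = 1%:M.
  by rewrite -scalemxAl cube_char_mx_sqr scale_scalar_mx mulVf.
have -> : adjacency_mx R (@consecutive_union n r) = H *m
    diag_mx (\row_j ((T (hamming_weight (enum_val j)) - 1)%:~R : R)%:C%C) *m G.
  rewrite -[LHS]mulmx1 -(mulmx1C GH) mulmxA adjacency_consecutive_union_eigen.
  by congr (_ *m diag_mx _ *m _); apply/rowP => j; rewrite !mxE rmorph_int.
rewrite transition_mx_diagonalized// /vertex_vec -colE.
apply/matrixP => x j0; rewrite [LHS]mxE mul_mx_diag mxE.
(* Writing basis vectors as columns of [H *m G = 1] lets both sides be compared character by
   character. *)
have delta_entry y :
    (delta_mx (enum_rank y) 0 : 'cV[R[i]]_#|{: n.-tuple bool}|) x j0 =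
    \sum_j H x j * G j (enum_rank y).
  have /matrixP/(_ x (enum_rank y)) := mulmx1C GH; rewrite !mxE => ->.
  by rewrite (ord1 j0) andbT.
rewrite mxE [X in X + _]mxE [X in _ + X]mxE !delta_entry !mulr_sumr -big_split /=.
apply: eq_bigr => j _; rewrite !mxE !enum_rankK cube_char0 cube_char1.
rewrite -/(a (hamming_weight (enum_val j))) cis_weight ?hamming_weight_le//.
by rewrite ab_cis rmorphXn rmorphN1 mulr1z; ring.
Qed.
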